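(* Let $X$ be a Banach space whose dual is locally uniformly convex, and let $U\subseteq X$ be open and convex. For every convex function $f:U\to\mathbb{R}$ which is bounded on bounded subsets $B$ of $U$ with $\mathrm{dist}(B,\partial U)>0$, and for every $\varepsilon>0$, there exists a $C^1$ convex function $g:U\to\mathbb{R}$ such that $f-\varepsilon\leq g\leq f$ on $U$. Moreover, $g$ can be taken so as to preserve the set of minimizers and the local Lipschitz constants of $f$. And if $f$ is strictly convex and $X$ is reflexive, $g$ can be taken to be strictly convex as well.
   Context: When $U=X$, one uses the convention $\mathrm{dist}(B,\partial U)=\infty$ for every bounded $B$. Preserving the set of minimizers means that $g$ and $f$ have the same set of minimizers. Preserving local Lipschitz constants means $\mathrm{Lip}(g_{|_B})\leq\mathrm{Lip}(f_{|_{(1+\varepsilon)B}})$ for every ball $B\subset U$, where $\mathrm{Lip}(h_{|_S})$ is the Lipschitz constant of $h$ on $S$ and $(1+\varepsilon)B$ is the concentric ball with radius multiplied by $1+\varepsilon$ (intersected with $U$). $f$ is strictly convex if $f((1-t)x+ty)<(1-t)f(x)+tf(y)$ for $x\neq y$ and $0<t<1$. *)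

(* Defs.v *)
From HB Require Import structures.
From mathcomp Require Import all_boot all_order all_algebra.
From mathcomp Require Import all_classical all_reals all_analysis.

Set Implicit Arguments.
Unset Strict Implicit.
Unset Printing Implicit Defensive.

Import Order.TTheory GRing.Theory Num.Theory.
Import numFieldNormedType.Exports.

Local Open Scope classical_set_scope.
Local Open Scope ring_scope.

Section DualSpace.
Context {R : realType} (V : normedModType R).

Definition dual_pred : {pred (V -> R^o)} :=
  fun phi => `[< linear phi /\ continuous phi >].

Lemma dual_pred_submod : submod_closed dual_pred.
Proof.
split=> [|a phi psi /asboolP[lphi cphi] /asboolP[lpsi cpsi]]; apply/asboolP.
  split=> [b x y|x]; first by rewrite /= scaler0 addr0.
  exact: cst_continuous.
split=> [b x y|x].
  rewrite !fctE /= lphi lpsi !scalerDr !scalerA addrACA.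
  by rewrite (mulrC a b).
apply: (@continuousD R R^o V (a *: phi) psi); last exact: cpsi.
by apply: (@cvgZl_tmp R R^o V (nbhs x)); exact: cphi.
Qed.

HB.instance Definition _ :=
  GRing.isSubmodClosed.Build R (V -> R^o) dual_pred dual_pred_submod.

Record dual_space := Dual {
  dual_fun :> V -> R^o;
  dual_funP : dual_fun \in dual_pred }.

HB.instance Definition _ := [isSub for dual_fun].
HB.instance Definition _ := [Choice of dual_space by <:].
HB.instance Definition _ := [SubChoice_isSubLmodule of dual_space by <:].

Lemma dual_space_linear (phi : dual_space) : linear phi.
Proof. by have /asboolP[] := dual_funP phi. Qed.

HB.instance Definition _ (phi : dual_space) :=
  GRing.isLinear.Build R V R^o *:%R phi (@dual_space_linear phi).

Lemma dual_space_continuous (phi : dual_space) : continuous phi.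
Proof. by have /asboolP[] := dual_funP phi. Qed.

Definition dual_norm (phi : dual_space) : R :=
  sup [set `|phi x| | x in [set x : V | `|x| <= 1]].

Lemma dual_norm_has_sup (phi : dual_space) :
  has_sup [set `|phi x| | x in [set x : V | `|x| <= 1]].
Proof.
split; first by exists `|phi 0|, 0 => //=; rewrite normr0.
have /linear_boundedP : bounded_near phi (nbhs (0 : V)).
  by apply/linear_bounded_continuous; exact: dual_space_continuous.
move=> /pinfty_ex_gt0[M M0 phiM]; exists M => _ [x /= x1 <-].
by rewrite (le_trans (phiM x))// ler_piMr// ltW.
Qed.

Lemma dual_norm_ub (phi : dual_space) (x : V) :
  `|x| <= 1 -> `|phi x| <= dual_norm phi.
Proof.
by move=> x1; apply: sup_upper_bound; [exact: dual_norm_has_sup|exists x].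
Qed.

Lemma dual_norm_lub (phi : dual_space) (M : R) :
  (forall x : V, `|x| <= 1 -> `|phi x| <= M) -> dual_norm phi <= M.
Proof.
move=> phiM; apply: ge_sup; first by have [] := dual_norm_has_sup phi.
by move=> _ [x /= x1 <-]; exact: phiM.
Qed.

Lemma dual_normD (phi psi : dual_space) :
  dual_norm (phi + psi) <= dual_norm phi + dual_norm psi.
Proof.
apply: dual_norm_lub => x x1; rewrite (le_trans (ler_normD (phi x) (psi x)))//.
by rewrite lerD// dual_norm_ub.
Qed.

Lemma dual_normZ (a : R) (phi : dual_space) :
  dual_norm (a *: phi) = `|a| * dual_norm phi.
Proof.
apply/eqP; rewrite eq_le; apply/andP; split.
  apply: dual_norm_lub => x x1; rewrite [leLHS](normrM a (phi x)).
  by rewrite ler_wpM2l// dual_norm_ub.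
have [->|a0] := eqVneq a 0.
  rewrite normr0 mul0r (le_trans (normr_ge0 ((0 *: phi) 0)))//.
  by rewrite dual_norm_ub// normr0.
rewrite mulrC -ler_pdivlMr ?normr_gt0//; apply: dual_norm_lub => x x1.
rewrite ler_pdivlMr ?normr_gt0// mulrC -normrM.
exact: (dual_norm_ub (a *: phi)).
Qed.

Lemma dual_norm0_eq0 (phi : dual_space) : dual_norm phi = 0 -> phi = 0.
Proof.
move=> phi0; apply/val_inj/funext => x /=.
have phi10 y : `|y| <= 1 -> phi y = 0.
  by move=> y1; apply/normr0_eq0/le_anti; rewrite -{1}phi0 dual_norm_ub/=.
have [->|x0] := eqVneq x 0; first exact: linear0.
have /phi10 : `| `|x|^-1 *: x | <= 1.
  by rewrite normrZ normfV normr_id mulVf// normr_eq0.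
rewrite linearZ /= => /eqP; rewrite scaler_eq0 invr_eq0 normr_eq0.
by rewrite (negPf x0) => /eqP.
Qed.

HB.instance Definition _ := Lmodule_isNormed.Build R dual_space
  dual_normD dual_normZ dual_norm0_eq0.

End DualSpace.

Section GeometryOfBanachSpaces.
Context {R : realType}.

Definition locally_uniformly_convex (E : normedModType R) :=
  forall x : E, `|x| = 1 -> forall e : R, 0 < e ->
  exists2 d : R, 0 < d &
    forall y : E, `|y| = 1 -> e <= `|x - y| -> `|x + y| / 2 <= 1 - d.

Definition reflexive_space (E : normedModType R) :=
  forall Phi : dual_space (dual_space E),
  exists x : E, forall phi : dual_space E, Phi phi = phi x.

End GeometryOfBanachSpaces.

Section FunctionsOnSubsets.
Context {R : realType} {V : normedModType R}.
Implicit Types (A B U : set V) (f g : V -> R).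

Definition boundary A := closure A `\` interior A.

(* Since ereal_inf set0 = +oo, every set is at distance +oo from the boundary
   of setT, which is empty. *)
Definition set_dist A B : \bar R :=
  ereal_inf [set (`|x - y|)%:E | x in A & y in B].

Definition strictly_convex_function U f :=
  forall x y, U x -> U y -> x != y -> forall t : R, 0 < t -> t < 1 ->
  f ((1 - t) *: x + t *: y) < (1 - t) * f x + t * f y.

(* The continuity of the Frechet derivative is relative to the operator norm. *)
Definition C1_on U g :=
  exists2 D : V -> dual_space V,
    forall x, U x -> is_diff x g (D x) & {in U, continuous D}.

Definition minimizers U f : set V :=
  [set x | U x /\ forall y, U y -> f x <= f y].

(* Equal to +oo if f is not Lipschitz on A. *)
Definition Lip A f : \bar R :=
  ereal_inf [set k%:E | k in [set k : R | 0 <= k /\ k.-lipschitz_A f]].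

(* Balls are open; as g is continuous in the applications, closed balls have the
   same Lipschitz constants as their interiors. *)
Definition preserves_local_Lip (e : R) U f g :=
  forall (x : V) (r : R), 0 < r -> ball x r `<=` U ->
  (Lip (ball x r) g <= Lip (ball x ((1 + e) * r) `&` U) f)%E.

End FunctionsOnSubsets.

(* Main.v *)
Require Import Defs.
From HB Require Import structures.
From mathcomp Require Import all_boot all_order all_algebra ring lra.
From mathcomp Require Import all_classical all_reals all_analysis.

Set Implicit Arguments.
Unset Strict Implicit.
Unset Printing Implicit Defensive.

Import Order.TTheory GRing.Theory Num.Theory.
Import numFieldNormedType.Exports.

Local Open Scope classical_set_scope.
Local Open Scope ring_scope.

(** The building block is the infimal convolution
    [fc x = inf_(y in U) (f y + c * `|x - y| ^+ 2)], which is convex, lies below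
    [f] and has the same infimum. A subgradient [q] of [fc] at [z] satisfies
    [fc z + q (y - z) + `|q| ^+ 2 / (4 * c) <= f y] for every [y] in [U]
    ([infconv_subgradient_ge]), the extra quadratic term coming from the
    conjugate of the kernel. This one inequality has two consequences.
    - Averaging it for subgradients [p] at [x] and [q] at [z] shows that the
      midpoint convexity defect of the squared dual norm between [p] and [q] is
      at most [2 * c * `|q - p| * `|z - x|] ([infconv_subgradient_gap]). When
      the dual is locally uniformly convex, subgradients therefore depend
      continuously on the point, in norm: [fc] is C1.
    - If [f y >= f x - L * `|y - x|] on [U], then [`|q| <= L] for every
      subgradient [q] of [fc] at [x] ([infconv_subgradient_norm]): [fc] is
      nowhere steeper than [f]. Moreover [f x - L ^+ 2 / (4 * c) <= fc x].

    Smoothness is carried throughout by a continuous selection of subgradients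
    ([C1_convex]), whose existence for [fc] is a form of the Hahn-Banach theorem
    ([linear_minorant]).

    The approximation by [fc] is uniform only where the slopes of [f] are
    bounded. Let [E n] be the set of points of [U] where the inequality above
    holds with [L = n]; as [f] is locally bounded, each point of [U] has a
    neighbourhood inside some [E n] ([slope_level_cover]). Choose [c n] so large
    that [fc] with [c = c n] is very close to [f] on [E n], lower it by an offset
    [o n] increasing with [n], and take the smooth maximum of all these
    functions. On [E n] the later ones stay below the earlier ones, so the
    maximum is locally finite ([locally_finite_smoothmax]). A smooth maximum
    built from the Huber function equals its first argument wherever this is
    the larger one, and its gradient is a convex combination of the gradients,
    so the bound by the slopes of [f] survives.

    The result lies between some [fc] and [f]; this alone makes its minimizers
    those of [f] ([minimizers_between_infconv]). Finally, averaging such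
    approximations for errors [e / j.+1] with geometric weights keeps all these
    properties, and the average is strictly convex when [f] is: an average that
    is affine on a segment averages functions that are affine there, and these
    converge to [f] ([smoothing_strict]). *)

(** * The norm of the dual space *)

Section Dual.
Context {R : realType} {V : normedModType R}.
Implicit Types (p q : dual_space V) (x y : V).

Lemma dualD_apply p q x : (p + q) x = p x + q x.
Proof. by []. Qed.

Lemma dualB_apply p q x : (p - q) x = p x - q x.
Proof. by []. Qed.

Lemma dualZ_apply (a : R) p x : (a *: p) x = a * p x.
Proof. by []. Qed.

Lemma dual_le_norm p x : `|p x| <= `|p| * `|x|.
Proof.
have [->|x0] := eqVneq x 0; first by rewrite linear0 !normr0 mulr0.
rewrite -ler_pdivrMr ?normr_gt0//.
have : `| `|x|^-1 *: x | <= 1 by rewrite normrZ normfV normr_id mulVf// normr_eq0.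
move=> /(dual_norm_ub p); rewrite linearZ/=; rewrite [ `|_ *: _|]normrM.
by rewrite normfV normr_id mulrC.
Qed.

Lemma dual_apply_le p x : p x <= `|p| * `|x|.
Proof. by rewrite (le_trans (ler_norm _)) ?dual_le_norm. Qed.

Lemma dual_norm_le p (M : R) :
  (forall x, `|x| <= 1 -> p x <= M) -> `|p| <= M.
Proof.
move=> pM; apply: dual_norm_lub => x x1; rewrite ler_norml pM// andbT.
by rewrite lerNl -linearN pM// normrN.
Qed.

Lemma dual_of_linear (k : V -> R^o) (M : R) : linear k ->
  (forall x, `|k x| <= M * `|x|) -> exists p, forall x, p x = k x.
Proof.
move=> klin kM.
pose kL : {linear V -> R^o} := HB.pack k (GRing.isLinear.Build R V R^o *:%R k klin).
have kc : continuous kL.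
  apply/linear_bounded_continuous/linear_boundedP.
  exists M; split=> [|r /ltW Mr x]; first exact: num_real.
  by rewrite (le_trans (kM x))// ler_wpM2r.
have kP : k \in @dual_pred R V by apply/asboolP; split.
by exists (Dual kP).
Qed.

End Dual.

(** * Local uniform convexity and the squared norm *)

Section SquaredNormGap.
Context {R : realType} {E : normedModType R}.
Implicit Types p q : E.

(** The midpoint convexity defect of the squared norm. *)
Definition sqr_gap p q : R :=
  (`|p| ^+ 2 + `|q| ^+ 2) / 2 - (`|p + q| / 2) ^+ 2.

Lemma sqr_gap_ge_normB p q : (`|p| - `|q|) ^+ 2 / 4 <= sqr_gap p q.
Proof.
have := ler_normD p q; have := normr_ge0 (p + q); rewrite /sqr_gap.
by move: `|p| `|q| `|p + q| => a b s; nra.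
Qed.

(** A small gap makes the norms of [p] and [q] close, by the triangle
    inequality, and then [p + q] almost as long as possible; after
    normalization local uniform convexity applies at [p]. *)
Lemma sqr_gap_luc : locally_uniformly_convex E ->
  forall p (e : R), 0 < e ->
  exists2 n : R, 0 < n & forall q, sqr_gap p q <= n -> `|p - q| < e.
Proof.
move=> luc p e e0; have [->|p0] := eqVneq p 0.
  exists ((e / 2) ^+ 2 / 4) => [|q]; first by rewrite divr_gt0// exprn_gt0// divr_gt0.
  move=> /(le_trans (sqr_gap_ge_normB 0 q)); rewrite normr0 sub0r sqrrN sub0r normrN.
  by have := normr_ge0 q; move: `|q| => b; nra.
set a := `|p|; have a0 : 0 < a by rewrite normr_gt0.
have unit (x : E) : x != 0 -> `| `|x|^-1 *: x | = 1.
  by move=> x0; rewrite normrZ normfV normr_id mulVf// normr_eq0.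
have e2a0 : 0 < e / (2 * a) by rewrite divr_gt0// mulr_gt0.
have [d d0 dP] := luc _ (unit _ p0) _ e2a0.
(* [s] will bound the difference of the norms of [p] and [q]; it is small
   enough for the deficit [d] to outweigh the error made by normalizing [q] *)
pose s := Num.min (e / 2) (Num.min (a / 2) (a * Num.min d 1 / 8)).
have s0 : 0 < s by rewrite !lt_min !divr_gt0//= mulr_gt0// lt_min d0 ltr01.
have [sa se sd] : [/\ s <= a / 2, s <= e / 2 & s <= a * Num.min d 1 / 8].
  by rewrite /s; split; rewrite !ge_min lexx ?orbT.
have d1 : 0 < Num.min d 1 <= 1 by rewrite lt_min d0 ltr01/= ge_min lexx orbT.
set m := Num.min d 1 in sd d1.
have md : m <= d by rewrite ge_min lexx.
exists (Num.min (s ^+ 2 / 4) (a ^+ 2 * m / 8)) => [|q].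
  by rewrite lt_min !divr_gt0// ?exprn_gt0//= mulr_gt0 ?exprn_gt0//; case/andP: d1.
rewrite le_min => /andP[g1 g2]; rewrite ltNge; apply/negP => epq.
set b := `|q|.
have sab : (a - b) ^+ 2 <= s ^+ 2.
  by have := le_trans (sqr_gap_ge_normB p q) g1; rewrite -/a -/b; lra.
have {}sab : a - s <= b <= a + s.
  by move: sab s0; clear; clearbody a b s => sab s0; apply/andP; split; nra.
have b0 : 0 < b by lra.
have q0 : q != 0 by rewrite -normr_gt0.
pose u := a^-1 *: p; pose v := b^-1 *: q.
have pE : p = a *: u by rewrite scalerA mulfV ?scale1r// gt_eqF.
have qE : q = a *: v + (b - a) *: v.
  by rewrite -scalerDl addrC subrK scalerA mulfV ?scale1r// gt_eqF.
have v1 : `|v| = 1 by exact: unit.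
have bas : `|(b - a) *: v| <= s by rewrite normrZ v1 mulr1 ler_norml; lra.
have uv : e / (2 * a) <= `|u - v|.
  rewrite ler_pdivrMr ?mulr_gt0//.
  have : `|p - q| <= a * `|u - v| + s.
    rewrite {1}pE {1}qE opprD addrA -scalerBr (le_trans (ler_normB _ _))//.
    by rewrite lerD// normrZ gtr0_norm.
  by lra.
have {}dP := dP _ v1 uv.
have pq : `|p + q| <= a * `|u + v| + s.
  rewrite {1}pE {1}qE addrA -scalerDr (le_trans (ler_normD _ _))//.
  by rewrite lerD// normrZ gtr0_norm.
have : `|p + q| / 2 <= a * (1 - m) + s / 2.
  have : a * `|u + v| <= a * (2 * (1 - m)) by rewrite ler_pM2l//; lra.
  lra.
move: g2; rewrite /sqr_gap -/a -/b.
have := normr_ge0 (p + q); move: `|p + q| => t t0 g2 tm.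
have : (t / 2) ^+ 2 <= (a * (1 - m / 2)) ^+ 2.
  by rewrite ler_pXn2r ?nnegrE//; nra.
have : (a - s) ^+ 2 <= b ^+ 2 by rewrite ler_pXn2r ?nnegrE//; lra.
have : a * s <= a * (a * m / 8) by rewrite ler_pM2l.
by nra.
Qed.

End SquaredNormGap.

(** * Convex functions have subgradients *)

Section ConvexFunctions.
Context {R : realType} {E : lmodType R}.
Implicit Types (D : set E) (h : E -> R^o) (x y : E) (t : R).

Lemma convex_functionP D h : convex_function D h <->
  forall x y t, D x -> D y -> 0 <= t <= 1 ->
    h (t *: x + (1 - t) *: y) <= t * h x + (1 - t) * h y.
Proof.
split=> [hc x y t Dx Dy /andP[t0 t1]|hc t x y].
  exact: (hc (Itv01 t0 t1) x y (mem_set Dx) (mem_set Dy)).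
by rewrite !inE => Dx Dy; apply: hc => //; rewrite ge0 le1.
Qed.

Lemma convex_set_comb D x y t : convex_set D -> D x -> D y -> 0 <= t <= 1 ->
  D (t *: x + (1 - t) *: y).
Proof.
move=> Dc Dx Dy /andP[t0 t1].
exact/set_mem/(Dc x y (Itv01 t0 t1) (mem_set Dx) (mem_set Dy)).
Qed.

(** By Zorn's lemma there is a minimal [k] among the convex functions below [h]
    vanishing at the origin. Neither the rescaling [x |-> t^-1 * k (t *: x)],
    for [t <= 1], nor the recentring [x |-> k (x + y) - k y] increases [k], so
    by minimality neither changes it: [k] is homogeneous and additive. *)
Lemma linear_minorant h : convex_function [set: E] h -> h 0 = 0 ->
  exists2 k : E -> R^o, linear k & forall x, k x <= h x.
Proof.
move=> hc h0.
pose good (k : E -> R^o) := [/\ convex_function [set: E] k, k 0 = 0 & forall x, k x <= h x].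
pose T := {k : E -> R^o | good k}.
pose below (k1 k2 : T) := `[< forall x, sval k2 x <= sval k1 x >].
have good_ge k x : good k -> - h (- x) <= k x.
  move=> [/convex_functionP kc k0 kh].
  have := kc x (- x) 2^-1 I I; rewrite scalerN -scalerBl.
  have -> : 2^-1 - (1 - 2^-1) = 0 :> R by lra.
  rewrite scale0r k0; have := kh (- x) => + /(_ ltac:(lra)); lra.
have hgood : good h by [].
have [|k1 k2 k3 /asboolP k12 /asboolP k23|A Atot|[k kgood] kmin] :=
    @ZL_preorder T (exist _ h hgood) below.
- by move=> k; apply/asboolP.
- by apply/asboolP => x; rewrite (le_trans (k23 x)).
- have [A0|/set0P/negP/negPn/eqP ->] := pselect (A !=set0); last first.
    by exists (exist _ h hgood).
  pose S x := [set sval k x | k in A].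
  have Sinf x : has_inf (S x).
    split; first by have [k Ak] := A0; exists (sval k x), k.
    by exists (- h (- x)) => _ [k _ <-]; apply: good_ge; exact: svalP.
  pose i x : R^o := inf (S x).
  have iP k x : A k -> i x <= sval k x.
    by move=> Ak; apply: ge_inf; [exact: (Sinf x).2|exists k].
  have leiP x c : (forall k, A k -> c <= sval k x) -> c <= i x.
    move=> cA; apply: lb_le_inf; first exact: (Sinf x).1.
    by move=> _ [k Ak <-]; exact: cA.
  have igood : good i.
    split=> [||x].
    + apply/convex_functionP => x y t _ _ t01; apply/ler_addgt0Pr => e e0.
      have [_ [k1 Ak1 <-] k1x] := inf_adherent e0 (Sinf x).
      have [_ [k2 Ak2 <-] k2y] := inf_adherent e0 (Sinf y).
      have [k [Ak kx ky]] : exists k, [/\ A k, sval k x < i x + e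
          & sval k y < i y + e].
        have [/asboolP k12|/asboolP k21] := Atot _ _ Ak1 Ak2.
          by exists k2; split => //; rewrite (le_lt_trans (k12 x)).
        by exists k1; split => //; rewrite (le_lt_trans (k21 y)).
      have [/convex_functionP kc _ _] := svalP k.
      apply: le_trans (iP k _ Ak) _; apply: le_trans (kc x y t I I t01) _.
      by move: t01 => /andP[]; nra.
    + apply/eqP; rewrite eq_le; apply/andP; split.
        by have [k Ak] := A0; have [_ <- _] := svalP k; exact: iP.
      by apply: leiP => k _; have [_ -> _] := svalP k.
    + have [k Ak] := A0; have [_ _ kh] := svalP k.
      exact: le_trans (iP k x Ak) (kh x).
  by exists (exist _ i igood) => k Ak; apply/asboolP => x; exact: iP.
have {}kmin k' : convex_function [set: E] k' -> k' 0 = 0 ->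
    (forall x, k' x <= k x) -> forall x, k x <= k' x.
  move=> k'c k'0 k'k x; have k'good : good k'.
    by split => // y; have [_ _ kh] := kgood; exact: le_trans (k'k y) (kh y).
  have /asboolP := kmin (exist _ k' k'good) ltac:(by apply/asboolP).
  exact.
have [/convex_functionP kc k0 kh] := kgood.
have kZ01 t x : 0 < t <= 1 -> k (t *: x) = t * k x.
  move=> /andP[t0 t1]; apply/eqP; rewrite eq_le; apply/andP; split.
    have := kc x 0 t I I; rewrite scaler0 addr0 k0 mulr0 addr0; apply.
    by rewrite ltW.
  have := kmin (fun x => t^-1 * k (t *: x)) _ _ _ x.
  rewrite ler_pdivlMl//; apply.
  + apply/convex_functionP => y z s _ _ s01.
    rewrite !(mulrCA _ t^-1) -mulrDr ler_pM2l ?invr_gt0//.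
    rewrite scalerDr !scalerA mulrC (mulrC t (1 - s)) -!scalerA.
    exact: kc.
  + by rewrite scaler0 k0 mulr0.
  + move=> y; rewrite ler_pdivrMl//.
    have := kc y 0 t I I; rewrite scaler0 addr0 k0 mulr0 addr0; apply.
    by rewrite ltW.
have kZ t x : 0 < t -> k (t *: x) = t * k x.
  move=> t0; have [t1|/ltW t1] := leP t 1; first by rewrite kZ01// t0.
  have /(kZ01 t^-1 (t *: x)) : 0 < t^-1 <= 1 by rewrite invr_gt0 t0 invf_le1.
  by rewrite scalerA mulVf ?gt_eqF// scale1r => ->; rewrite mulrA mulfV ?gt_eqF// mul1r.
have kD_le x y : k (x + y) <= k x + k y.
  have := kc (2 *: x) (2 *: y) 2^-1 I I ltac:(lra).
  have -> : 1 - 2^-1 = 2^-1 :> R by lra.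
  by rewrite !scalerA mulVf ?pnatr_eq0// !scale1r !kZ// !mulrA mulVf ?pnatr_eq0// !mul1r.
have kD x y : k (x + y) = k x + k y.
  apply/eqP; rewrite eq_le kD_le/= -lerBrDr.
  apply: (kmin (fun x => k (x + y) - k y)) => [||z].
  + apply/convex_functionP => a b t _ _ t01.
    have -> : t *: a + (1 - t) *: b + y = t *: (a + y) + (1 - t) *: (b + y).
      by rewrite !scalerDr addrACA -scalerDl (addrCA t) subrr addr0 scale1r.
    by have := kc (a + y) (b + y) t I I t01; lra.
  + by rewrite add0r subrr.
  + by rewrite lerBlDr kD_le.
have kN x : k (- x) = - k x by apply/eqP; rewrite -addr_eq0 -kD addNr k0.
exists k => // a x y; rewrite kD; congr (_ + _).
have [a0|a0|->] := ltgtP a 0; last by rewrite !scale0r k0.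
  by rewrite -[a]opprK scaleNr kN kZ ?oppr_gt0// scaleNr.
exact: kZ.
Qed.

End ConvexFunctions.

Section SubgradientExistence.
Context {R : realType} {V : normedModType R}.

(** The linear minorant of [v |-> h (x + v) - h x] is bounded above on a ball
    by the assumption on [h], hence continuous. *)
Lemma subgradient_exists (h : V -> R^o) x (r M : R) : 0 < r ->
  convex_function [set: V] h -> (forall v, `|v| <= r -> h (x + v) <= M) ->
  exists p : dual_space V, forall y, h x + p (y - x) <= h y.
Proof.
move=> r0 /convex_functionP hc hM.
have [||k klin kh] := @linear_minorant R V (fun v => h (x + v) - h x).
- apply/convex_functionP => a b t _ _ t01.
  have -> : x + (t *: a + (1 - t) *: b) = t *: (x + a) + (1 - t) *: (x + b).
    by rewrite !scalerDr addrACA -scalerDl (addrCA t) subrr addr0 scale1r.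
  by have := hc (x + a) (x + b) t I I t01; lra.
- by rewrite addr0 subrr.
pose kL : {linear V -> R^o} := HB.pack k (GRing.isLinear.Build R V R^o *:%R k klin).
have kM v : `|v| <= r -> k v <= M - h x.
  by move=> vr; rewrite (le_trans (kh v))// lerB// hM.
have [|p pk] := @dual_of_linear R V k ((M - h x) / r) klin.
  move=> v; have [->|v0] := eqVneq v 0.
    by rewrite -[k 0]/(kL 0) linear0 !normr0 mulr0.
  have v0' : 0 < `|v| by rewrite normr_gt0.
  have key w : `|w| = `|v| -> k w <= (M - h x) / r * `|v|.
    move=> wv; have : `|(r / `|v|) *: w| <= r.
      by rewrite normrZ normrM normfV normr_id gtr0_norm// wv divfK// gt_eqF.
    move=> /kM; rewrite -[k _]/(kL _) linearZ/= -[_ *: _]/(_ * _) => kw.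
    rewrite mulrAC ler_pdivlMr// (_ : k w * r = r / `|v| * k w * `|v|).
      by rewrite ler_wpM2r.
    by rewrite mulrAC divfK ?gt_eqF// mulrC.
  rewrite ler_norml key// andbT lerNl -[k v]/(kL v) -linearN.
  by rewrite key// normrN.
exists p => y; rewrite pk; have := kh (y - x).
by rewrite (addrC x) subrK; lra.
Qed.

End SubgradientExistence.

(** * Infimal convolution with a multiple of the squared norm *)

Section Subgradients.
Context {R : realType} {V : normedModType R}.

Definition subgradient (D : set V) (g : V -> R) x (p : dual_space V) :=
  forall y, D y -> g x + p (y - x) <= g y.

(** One-sided and centred at [x], but over the whole of [D]: for a convex
    function it follows from an [L]-Lipschitz bound near [x], and it says that
    some subgradient at [x] has norm at most [L]. *)
Definition slope_bound (D : set V) (f : V -> R) (L : R) x :=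
  forall y, D y -> f x - L * `|y - x| <= f y.

End Subgradients.

Section InfConvolution.
Context {R : realType} {V : normedModType R}.
Variables (U : set V) (f : V -> R).

Definition infconv (c : R) (x : V) : R :=
  inf [set f y + c * `|x - y| ^+ 2 | y in U].

Variables (x0 : V) (L0 : R).
Hypotheses (Ux0 : U x0) (L0_ge0 : 0 <= L0) (f_x0 : slope_bound U f L0 x0).

Lemma infconv_has_inf c x : 0 < c ->
  has_inf [set f y + c * `|x - y| ^+ 2 | y in U].
Proof.
move=> c0; split; first by exists (f x0 + c * `|x - x0| ^+ 2), x0.
exists (f x0 - L0 * `|x - x0| - L0 ^+ 2 / (4 * c)) => _ [y Uy <-].
have := f_x0 Uy; have := ler_distD x y x0; rewrite (distrC y x).
move: `|y - x0| `|x - y| `|x - x0| => a s b asb fy.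
have : L0 * a <= L0 * (s + b) by rewrite ler_wpM2l.
have : 0 <= (2 * c * s - L0) ^+ 2 / (4 * c) by rewrite divr_ge0 ?sqr_ge0// mulr_ge0// ltW.
have -> : (2 * c * s - L0) ^+ 2 / (4 * c) = c * s ^+ 2 - L0 * s + L0 ^+ 2 / (4 * c).
  by field; rewrite gt_eqF.
lra.
Qed.

Lemma infconv_le c x y : 0 < c -> U y -> infconv c x <= f y + c * `|x - y| ^+ 2.
Proof.
by move=> c0 Uy; apply: ge_inf; [exact: (infconv_has_inf x c0).2|exists y].
Qed.

Lemma infconv_ge c x m :
  (forall y, U y -> m <= f y + c * `|x - y| ^+ 2) -> m <= infconv c x.
Proof.
move=> mP; apply: lb_le_inf; first by exists (f x0 + c * `|x - x0| ^+ 2), x0.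
by move=> _ [y Uy <-]; exact: mP.
Qed.

Lemma infconv_le_self c x : 0 < c -> U x -> infconv c x <= f x.
Proof.
move=> c0 Ux; rewrite (le_trans (infconv_le x c0 Ux))//.
by rewrite subrr normr0 expr0n mulr0 addr0.
Qed.

(** For all [s], [c * s ^+ 2 - L * s] is at least [- L ^+ 2 / (4 * c)]. *)
Lemma infconv_near c L x : 0 < c -> slope_bound U f L x ->
  f x - L ^+ 2 / (4 * c) <= infconv c x.
Proof.
move=> c0 fL; apply: infconv_ge => y /fL; rewrite (distrC x y).
move: `|y - x| => s.
have : 0 <= (2 * c * s - L) ^+ 2 / (4 * c) by rewrite divr_ge0 ?sqr_ge0// mulr_ge0// ltW.
have -> : (2 * c * s - L) ^+ 2 / (4 * c) = c * s ^+ 2 - L * s + L ^+ 2 / (4 * c).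
  by field; rewrite gt_eqF.
lra.
Qed.

Lemma infconv_convex c : 0 < c -> convex_set U -> convex_function U f ->
  convex_function [set: V] (infconv c).
Proof.
move=> c0 Uc /convex_functionP fc; apply/convex_functionP => x y t _ _ t01.
apply/ler_addgt0Pr => e e0.
have [_ [a Ua <-] ax] := inf_adherent e0 (infconv_has_inf x c0).
have [_ [b Ub <-] b_y] := inf_adherent e0 (infconv_has_inf y c0).
have Uab : U (t *: a + (1 - t) *: b) by exact: convex_set_comb.
apply: le_trans (infconv_le _ c0 Uab) _.
have fab := fc a b t Ua Ub t01.
have -> : t *: x + (1 - t) *: y - (t *: a + (1 - t) *: b) =
    t *: (x - a) + (1 - t) *: (y - b) by rewrite !scalerBr opprD addrACA.
have {t01}/andP[t0 t1] := t01; have t1' : 0 <= 1 - t by lra.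
have sab : `|t *: (x - a) + (1 - t) *: (y - b)| ^+ 2 <=
    t * `|x - a| ^+ 2 + (1 - t) * `|y - b| ^+ 2.
  have := ler_normD (t *: (x - a)) ((1 - t) *: (y - b)); rewrite !normrZ !ger0_norm//.
  move: `|_ + _| (normr_ge0 (t *: (x - a) + (1 - t) *: (y - b))) => s s0.
  move: `|x - a| `|y - b| (normr_ge0 (x - a)) (normr_ge0 (y - b)) => d d' d0 d'0 sd.
  have : s ^+ 2 <= (t * d + (1 - t) * d') ^+ 2 by rewrite ler_pXn2r ?nnegrE//; nra.
  have : 0 <= t * (1 - t) * (d - d') ^+ 2 by rewrite mulr_ge0 ?sqr_ge0// mulr_ge0.
  lra.
rewrite -/(infconv c x) -/(infconv c y) in ax b_y.
have := ler_wpM2l (ltW c0) sab.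
have := ler_wpM2l t0 (ltW ax); have := ler_wpM2l t1' (ltW b_y).
lra.
Qed.

Lemma infconv_subgradient_exists c x : 0 < c -> convex_set U ->
  convex_function U f -> exists p, subgradient [set: V] (infconv c) x p.
Proof.
move=> c0 Uc fc.
have [v v1|p pP] := @subgradient_exists R V (infconv c) x 1
    (f x0 + c * (`|x - x0| + 1) ^+ 2) ltr01 (infconv_convex c0 Uc fc).
- rewrite (le_trans (infconv_le _ c0 Ux0))// lerD2l; apply: ler_wpM2l; first exact: ltW.
  rewrite ler_pXn2r ?nnegrE ?addr_ge0//.
  by rewrite addrAC (le_trans (ler_normD _ _))// lerD2l.
- by exists p => y _; exact: pP.
Qed.

(** The Fenchel conjugate of [infconv c] is that of [f] plus
    [`|q| ^+ 2 / (4 * c)]; this is the instance of that formula at a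
    subgradient [q], where the conjugate of [infconv c] is known. *)
Lemma infconv_subgradient_ge c z q y : 0 < c ->
  subgradient [set: V] (infconv c) z q -> U y ->
  infconv c z + q (y - z) + `|q| ^+ 2 / (4 * c) <= f y.
Proof.
move=> c0 qz Uy; set C := f y - infconv c z - q (y - z).
suff : `|q| ^+ 2 / (4 * c) <= C by rewrite /C; lra.
have qC (u : V) : `|u| <= 1 -> q u ^+ 2 <= 4 * c * C.
  move=> u1; pose t : R := q u / (2 * c).
  have := qz (y + t *: u) I; rewrite addrAC linearD linearZ/= -[_ *: _]/(t * q u).
  move=> /le_trans/(_ (infconv_le _ c0 Uy)).
  rewrite addrAC subrr add0r normrZ exprMn real_normK ?num_real// => quC.
  have : c * (t ^+ 2 * `|u| ^+ 2) <= c * t ^+ 2.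
    by rewrite ler_pM2l// ler_piMr ?sqr_ge0// expr_le1.
  have tE : t * (2 * c) = q u by rewrite divfK// mulf_neq0 ?gt_eqF.
  rewrite /C; clearbody t.
  move: tE quC; move: (q u) (q (y - z)) (infconv c z) => k l i <- quC tu.
  have : 4 * c * (c * t ^+ 2) <= 4 * c * (f y - i - l).
    by apply: ler_wpM2l; [rewrite mulr_ge0// ltW|lra].
  lra.
have C0 : 0 <= 4 * c * C by have := qC 0; rewrite normr0 linear0 expr0n; apply.
rewrite ler_pdivrMr ?mulr_gt0// (mulrC C) -(sqr_sqrtr C0) ler_pXn2r ?nnegrE//.
apply: dual_norm_le => u u1.
rewrite (le_trans (ler_norm _))// -sqrtr_sqr.
by rewrite ler_wsqrtr// qC.
Qed.

(** Averaging the inequalities of [infconv_subgradient_ge] for [p] and [q]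
    bounds [infconv c x] from below with an excess proportional to
    [sqr_gap p q]. *)
Lemma infconv_subgradient_gap c x z p q : 0 < c ->
  subgradient [set: V] (infconv c) x p -> subgradient [set: V] (infconv c) z q ->
  sqr_gap p q <= 2 * c * (`|q - p| * `|z - x|).
Proof.
move=> c0 px qz.
pose m := 2^-1 *: (p + q).
have mE v : m v = (p v + q v) / 2 by rewrite dualZ_apply dualD_apply mulrC.
have mN : `|m| = `|p + q| / 2 by rewrite normrZ gtr0_norm// mulrC.
pose g := infconv c.
have : (p x + q x) / 2 + (g x - p x + (g z - q z)) / 2 + (`|p| ^+ 2 + `|q| ^+ 2) / (8 * c)
    - `|m| ^+ 2 / (4 * c) <= g x.
  apply: infconv_ge => y Uy.
  have := infconv_subgradient_ge c0 px Uy.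
  have := infconv_subgradient_ge c0 qz Uy.
  rewrite !linearB/= -/(g x) -/(g z).
  have : m (x - y) <= `|m| * `|x - y| := dual_apply_le m (x - y).
  rewrite mE !linearB/=.
  move: `|m| `|x - y| => a s.
  have : 0 <= (2 * c * s - a) ^+ 2 / (4 * c) by rewrite divr_ge0 ?sqr_ge0// mulr_ge0// ltW.
  have -> : (2 * c * s - a) ^+ 2 / (4 * c) = c * s ^+ 2 - a * s + a ^+ 2 / (4 * c).
    by field; rewrite gt_eqF.
  have -> : (`|p| ^+ 2 + `|q| ^+ 2) / (8 * c) =
      (`|p| ^+ 2 / (4 * c) + `|q| ^+ 2 / (4 * c)) / 2 by field; rewrite gt_eqF.
  lra.
have := px z I; have := dual_apply_le (q - p) (z - x).
rewrite dualB_apply !linearB/= -/(g x) -/(g z) mN => h1 h2 h3.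
have : sqr_gap p q / (4 * c) <= (`|q - p| * `|z - x|) / 2.
  rewrite (_ : sqr_gap p q / (4 * c) = (`|p| ^+ 2 + `|q| ^+ 2) / (8 * c)
    - (`|p + q| / 2) ^+ 2 / (4 * c)); last by rewrite /sqr_gap; field; rewrite gt_eqF.
  move: h1 h2 h3; lra.
by rewrite ler_pdivrMr ?mulr_gt0//; lra.
Qed.

(** As [z] tends to [x] the gap between [p] and [q] tends to [0], so the
    subgradients converge in norm by local uniform convexity of the dual. *)
Lemma infconv_subgradient_continuous c x p (e : R) :
  locally_uniformly_convex (dual_space V) -> 0 < c -> 0 < e ->
  subgradient [set: V] (infconv c) x p ->
  exists2 d : R, 0 < d & forall z q, `|z - x| < d ->
    subgradient [set: V] (infconv c) z q -> `|p - q| < e.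
Proof.
move=> luc c0 e0 px; have [n n0 nP] := sqr_gap_luc luc p e0.
have a0 := normr_ge0 p.
exists (Num.min 1 (n / (4 * `|p| + 16)) / (2 * c)) => [|z q].
  by rewrite divr_gt0 ?mulr_gt0// lt_min ltr01 divr_gt0//; lra.
rewrite ltr_pdivlMr ?mulr_gt0// lt_min ltr_pdivlMr; last by lra.
move=> /andP[z1 zn] qz; apply: nP.
have gap := infconv_subgradient_gap c0 px qz.
have gapB := sqr_gap_ge_normB p q.
have := normr_ge0 (z - x); move: `|z - x| z1 zn gap => r rc1 rcn gap r0.
have rc0 : 0 <= r * (2 * c) by rewrite mulr_ge0// mulr_ge0// ltW.
have gap1 : sqr_gap p q <= r * (2 * c) * (`|p| + `|q|).
  rewrite (_ : 2 * c * (`|q - p| * r) = r * (2 * c) * `|q - p|) in gap; last by ring.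
  by rewrite (le_trans gap)// ler_wpM2l// (addrC `|p|) ler_normB.
(* the gap is at least quadratic in the difference of the norms, while
   [gap1] bounds it linearly, so [q] cannot be too long *)
have q_le : `|q| <= 3 * `|p| + 16.
  rewrite leNgt; apply/negP => q_gt.
  have : sqr_gap p q <= `|p| + `|q|.
    by rewrite (le_trans gap1)// ler_piMl ?addr_ge0// ltW.
  by move: gapB q_gt a0; move: `|p| `|q| (sqr_gap p q) => a b s; nra.
apply: le_trans gap1 _; apply: le_trans (ltW rcn).
by rewrite ler_wpM2l//; lra.
Qed.

(** Fitting the two bounds [infconv_near] and [infconv_subgradient_ge] for
    [f x - infconv c x] together: the infimal convolution is never steeper
    than [f]. *)
Lemma infconv_subgradient_norm c L x q : 0 < c -> 0 <= L -> U x ->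
  slope_bound U f L x -> subgradient [set: V] (infconv c) x q -> `|q| <= L.
Proof.
move=> c0 L0' Ux fL qx; rewrite -(ler_pXn2r (n := 2)) ?nnegrE//.
have := infconv_subgradient_ge c0 qx Ux; rewrite subrr linear0.
have := infconv_near c0 fL; rewrite addr0 => h1 h2.
have : `|q| ^+ 2 / (4 * c) <= L ^+ 2 / (4 * c) by lra.
by rewrite ler_pM2r// invr_gt0 mulr_gt0.
Qed.

End InfConvolution.

(** * Convex functions with a continuous gradient *)

Section SmoothConvexFunctions.
Context {R : realType} {V : normedModType R}.
Implicit Types (A : set V) (g h : V -> R) (D : V -> dual_space V).

(** A continuous selection of subgradients: it certifies both convexity and
    continuous differentiability, and it is preserved by the operations below
    without any differential calculus. *)
Definition C1_convex A g D :=
  forall x, A x -> subgradient A g x (D x) /\ {for x, continuous D}.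

(** The subgradient inequalities at [x] and at [h + x] confine the remainder
    between [0] and [`|D (h + x) - D x| * `|h|]. *)
Lemma C1_convex_is_diff A g D x : open A -> C1_convex A g D -> A x ->
  is_diff x g (D x).
Proof.
move=> oA gD Ax; have [gx Dx] := gD x Ax.
have Dc : continuous (D x) := @dual_space_continuous R V (D x).
have gE : g \o shift x = cst (g x) + D x +o_ 0 id.
  apply/eqaddoP => e e0; near=> h.
  have Ahx : A (h + x).
    near: h; have : nbhs (0 + x) A by rewrite add0r; exact: open_nbhs_nbhs.
    have /= := (@cvgD _ _ _ (nbhs (0 : V)) _ id (cst x) 0 x cvg_id (cvg_cst x)).
    by move=> /[apply].
  have De : `|D x - D (h + x)| < e.
    near: h; have : h + x @[h --> (0 : V)] --> x.
      by rewrite -[X in _ --> X]add0r; apply: cvgD; [exact: cvg_id|exact: cvg_cst].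
    by move=> /(cvg_comp _ D)/(_ Dx)/cvgr_dist_lt; apply.
  have [gxh _] := gD _ Ahx.
  have h1 := gx _ Ahx; have h2 := gxh _ Ax.
  rewrite addrK in h1; rewrite opprD addrCA subrr addr0 linearN/= in h2.
  have := dual_apply_le (D (h + x) - D x) h; rewrite distrC dualB_apply => h3.
  rewrite -[(_ - _) h]/(g (h + x) - (g x + D x h)) ger0_norm; last by lra.
  apply: (@le_trans _ _ (`|D x - D (h + x)| * `|h|)); first by lra.
  by rewrite ler_wpM2r// ltW.
have dE := diff_unique Dc gE.
by split=> //; apply/diff_locallyP; rewrite dE.
Unshelve. all: by end_near. Qed.

Lemma C1_convex_continuous A g D x : open A -> C1_convex A g D -> A x ->
  {for x, continuous g}.
Proof.
move=> oA gD Ax; have := C1_convex_is_diff oA gD Ax.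
by move=> gdiff; apply: differentiable_continuous; exact: ex_diff.
Qed.

Lemma C1_convex_convex A g D : convex_set A -> C1_convex A g D ->
  convex_function A g.
Proof.
move=> Ac gD; apply/convex_functionP => x y t Ax Ay /andP[t0 t1].
set z := t *: x + (1 - t) *: y.
have Az : A z by apply: convex_set_comb => //; rewrite t0 t1.
have [gz _] := gD z Az; have := gz x Ax; have := gz y Ay.
have -> : y - z = t *: (y - x).
  rewrite /z scalerBl scale1r scalerBr opprD opprB addrCA.
  by rewrite [y + _]addrC subrK addrC.
have -> : x - z = (1 - t) *: (x - y).
  by rewrite /z opprD addrA scalerBr !scalerBl !scale1r.
rewrite !linearZ/= !linearB/= -![_ *: _]/(_ * _) => h1 h2.
have t1' : 0 <= 1 - t by lra.
have := ler_wpM2l t0 h2; have := ler_wpM2l t1' h1; lra.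
Qed.

End SmoothConvexFunctions.

(** * Smooth maxima *)

Section SmoothMaximum.
Context {R : realType}.
Implicit Types d s t : R.

Definition clamp d s : R := Num.max 0 (Num.min 1 (s / d)).

(** The Huber function: the Legendre transform of [d * t ^+ 2 / 2] on [0, 1],
    a C1 approximation of the positive part vanishing exactly for [s <= 0]. *)
Definition huber d s : R := clamp d s * s - d * clamp d s ^+ 2 / 2.

Lemma clamp_itv d s : 0 <= clamp d s <= 1.
Proof. by rewrite /clamp le_max lexx/= ge_max ler01/= ge_min lexx. Qed.

Lemma clamp_le0 d s : 0 < d -> s <= 0 -> clamp d s = 0.
Proof.
move=> d0 s0; apply/max_idPl; rewrite ge_min; apply/orP; right.
by rewrite pmulr_lle0// invr_gt0.
Qed.

Lemma huber_le0 d s : 0 < d -> s <= 0 -> huber d s = 0.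
Proof. by move=> d0 s0; rewrite /huber clamp_le0//; ring. Qed.

Lemma huber_ge_affine d s t : 0 < d -> 0 <= t <= 1 ->
  t * s - d * t ^+ 2 / 2 <= huber d s.
Proof.
move=> d0 /andP[t0 t1]; have [s0|s0] := leP s 0.
  rewrite huber_le0// subr_le0 (@le_trans _ _ 0)//; first by rewrite mulr_ge0_le0.
  by rewrite divr_ge0// mulr_ge0 ?sqr_ge0// ltW.
rewrite /huber /clamp; have [sd|/ltW sd] := leP (s / d) 1.
  have sd0 : 0 <= s / d by rewrite divr_ge0// ltW.
  rewrite (max_r sd0).
  have [c sE ->] : exists2 c, s = c * d & s / d = c.
    by exists (s / d); rewrite // divfK// gt_eqF.
  rewrite sE.
  have : 0 <= d * (c - t) ^+ 2 by rewrite mulr_ge0 ?sqr_ge0// ltW.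
  lra.
rewrite max_r// mul1r expr1n mulr1.
move: sd; rewrite ler_pdivlMr// mul1r => sd.
have : 0 <= (1 - t) * (s - d) by rewrite mulr_ge0; lra.
have : 0 <= d * (1 - t) ^+ 2 by rewrite mulr_ge0 ?sqr_ge0// ltW.
lra.
Qed.

Lemma huber_tangent d s s' : 0 < d ->
  huber d s + clamp d s * (s' - s) <= huber d s'.
Proof.
move=> d0; apply: le_trans (huber_ge_affine s' d0 (clamp_itv d s)).
by rewrite /huber; lra.
Qed.

Lemma huber_ge0 d s : 0 < d -> 0 <= huber d s.
Proof.
by move=> d0; rewrite (le_trans _ (@huber_ge_affine _ _ 0 d0 _))//; lra.
Qed.

Lemma huber_ge d s : 0 < d -> s - d / 2 <= huber d s.
Proof.
by move=> d0; rewrite (le_trans _ (@huber_ge_affine _ _ 1 d0 _))//; lra.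
Qed.

Lemma huber_ub d a b M : 0 < d -> a <= M -> b <= M -> a + huber d (b - a) <= M.
Proof.
move=> d0 aM bM; rewrite /huber; have /andP[] := clamp_itv d (b - a).
move: (clamp _ _) => t t0 t1.
have : 0 <= (1 - t) * (M - a) by rewrite mulr_ge0; lra.
have : 0 <= t * (M - b) by rewrite mulr_ge0; lra.
have : 0 <= d * t ^+ 2 by rewrite mulr_ge0 ?sqr_ge0// ltW.
lra.
Qed.

Lemma clamp_continuous d : continuous (clamp d : R -> R^o).
Proof.
move=> s.
have -> : clamp d = (cst 0 : R -> R^o) \max ((cst 1 : R -> R^o) \min (fun x : R => x / d : R^o)).
  by [].
apply: continuous_max; first exact: cst_continuous.
apply: continuous_min; first exact: cst_continuous.
exact: (@mulrr_continuous R).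
Qed.

End SmoothMaximum.

Section SmoothMaximumOfFunctions.
Context {R : realType} {V : normedModType R}.
Implicit Types (A : set V) (g h : V -> R) (Dg Dh : V -> dual_space V) (d : R).

(** It equals [g] wherever [h <= g] and never exceeds the maximum of the two;
    the price is that it may fall short of [h] by [d / 2]. *)
Definition smoothmax d g h x := g x + huber d (h x - g x).

Definition smoothmax_grad d g Dg h Dh x : dual_space V :=
  (1 - clamp d (h x - g x)) *: Dg x + clamp d (h x - g x) *: Dh x.

Lemma C1_convex_smoothmax A d g Dg h Dh : open A -> 0 < d ->
  C1_convex A g Dg -> C1_convex A h Dh ->
  C1_convex A (smoothmax d g h) (smoothmax_grad d g Dg h Dh).
Proof.
move=> oA d0 gP hP x Ax; have [gx Dgx] := gP x Ax; have [hx Dhx] := hP x Ax.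
split=> [y Ay|].
  rewrite /smoothmax /smoothmax_grad dualD_apply !dualZ_apply.
  have := huber_tangent (h x - g x) (h y - g y) d0.
  have /andP[] := clamp_itv d (h x - g x).
  move: (clamp _ _) (huber d (h x - g x)) (huber d (h y - g y)) => t a b t0 t1 ab.
  have t1' : 0 <= 1 - t by lra.
  have := ler_wpM2l t0 (hx y Ay); have := ler_wpM2l t1' (gx y Ay).
  lra.
have tc : {for x, continuous (fun y => clamp d (h y - g y) : R^o)}.
  apply: (@continuous_comp _ _ _ (fun y => h y - g y)); last exact: clamp_continuous.
  apply: (@cvgB R R^o).
    exact: (C1_convex_continuous oA hP Ax).
  exact: (C1_convex_continuous oA gP Ax).
apply: (@cvgD _ (dual_space V)); apply: cvgZ => //.
by apply: (@cvgB R R^o) => //; exact: cvg_cst.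
Qed.

Lemma smoothmax_grad_norm d g Dg h Dh x L :
  `|Dg x| <= L -> `|Dh x| <= L -> `|smoothmax_grad d g Dg h Dh x| <= L.
Proof.
move=> gL hL; rewrite /smoothmax_grad; have /andP[] := clamp_itv d (h x - g x).
move: (clamp _ _) => t t0 t1; have t1' : 0 <= 1 - t by lra.
rewrite (le_trans (ler_normD _ _))// !normrZ !ger0_norm//.
have := ler_wpM2l t0 hL; have := ler_wpM2l t1' gL; lra.
Qed.

End SmoothMaximumOfFunctions.

Section LocallyFiniteSmoothMaximum.
Context {R : realType} {V : normedModType R}.
Variables (U : set V) (h : nat -> V -> R) (Dh : nat -> V -> dual_space V).
Variables (d : nat -> R) (E : nat -> set V).
Hypotheses (d_gt0 : forall n, 0 < d n).
Hypothesis h_C1 : forall n, C1_convex [set: V] (h n) (Dh n).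
Hypothesis E_homo : forall m n, (m <= n)%N -> E m `<=` E n.
Hypothesis E_sub : forall n, E n `<=` U.
Hypothesis E_cover : forall x, U x -> exists n, \forall y \near x, E n y.
Hypothesis h_decr : forall n x, E n x -> h n.+1 x + d n / 2 <= h n x.

Fixpoint smoothmax_seq n : (V -> R) * (V -> dual_space V) :=
  if n is m.+1 then
    let: (g, D) := smoothmax_seq m in
    (smoothmax (d n) g (h n), smoothmax_grad (d n) g D (h n) (Dh n))
  else (h 0%N, Dh 0%N).

Let G n := (smoothmax_seq n).1.
Let DG n := (smoothmax_seq n).2.

Let GS n : G n.+1 = smoothmax (d n.+1) (G n) (h n.+1).
Proof. by rewrite /G/=; case: smoothmax_seq. Qed.

Let DGS n : DG n.+1 = smoothmax_grad (d n.+1) (G n) (DG n) (h n.+1) (Dh n.+1).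
Proof. by rewrite /G /DG/=; case: smoothmax_seq. Qed.

Let G_C1 n : C1_convex [set: V] (G n) (DG n).
Proof.
elim: n => [|n IH]; first exact: h_C1.
by rewrite GS DGS; apply: C1_convex_smoothmax => //; exact: openT.
Qed.

Let G_ge n x : h n x - d n / 2 <= G n x.
Proof.
case: n => [|n]; first by rewrite gerBl divr_ge0// ltW.
by rewrite GS /smoothmax; have := huber_ge (h n.+1 x - G n x) (d_gt0 n.+1); lra.
Qed.

Let G_ge0 n x : h 0%N x <= G n x.
Proof.
elim: n => [//|n IH]; rewrite GS /smoothmax (le_trans IH)// lerDl.
exact: huber_ge0.
Qed.

Let G_le n x M : (forall m, h m x <= M) -> G n x <= M.
Proof.
move=> hM; elim: n => [|n IH]; first exact: hM.
by rewrite GS; apply: huber_ub.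
Qed.

Let DG_norm n x L : (forall m, `|Dh m x| <= L) -> `|DG n x| <= L.
Proof.
move=> hL; elim: n => [|n IH]; first exact: hL.
by rewrite DGS; apply: smoothmax_grad_norm.
Qed.

Let G_stationary n m x : E n x -> (n <= m)%N -> G m x = G n x /\ DG m x = DG n x.
Proof.
move=> Enx; elim: m => [|m IH]; first by rewrite leqn0 => /eqP ->.
rewrite leq_eqVlt => /predU1P[->//|]; rewrite ltnS => nm.
have [<- <-] := IH nm.
have hG : h m.+1 x - G m x <= 0.
  by have := h_decr (E_homo nm Enx); have := G_ge m x; lra.
rewrite GS DGS /smoothmax /smoothmax_grad huber_le0// clamp_le0//=.
by rewrite addr0 subr0 scale1r scale0r addr0.
Qed.

(** On [E n] the functions [h m] with [m > n] lie below [G n], so the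
    iterated smooth maxima are stationary there. *)
Lemma locally_finite_smoothmax : exists g D,
  [/\ C1_convex U g D,
      forall x, U x -> h 0%N x <= g x,
      forall n x, E n x -> h n x - d n / 2 <= g x,
      forall x M, (forall n, h n x <= M) -> g x <= M &
      forall x L, (forall n, `|Dh n x| <= L) -> `|D x| <= L].
Proof.
have [N NE] : exists N : V -> nat, forall x, U x -> E (N x) x.
  suff /choice[N] : forall x, exists n, U x -> E n x by exists N.
  move=> x; have [Ux|Ux] := pselect (U x); last by exists 0%N.
  by have [n /nbhs_singleton] := E_cover Ux; exists n.
have GN n x : E n x -> G (N x) x = G n x /\ DG (N x) x = DG n x.
  move=> Enx; have Ux := E_sub Enx.
  have [<- <-] := G_stationary (NE x Ux) (leq_maxl (N x) n).
  exact: G_stationary Enx (leq_maxr _ _).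
exists (fun x => G (N x) x), (fun x => DG (N x) x); split.
- move=> x Ux; split=> [y Uy|].
    have Ex := E_homo (leq_maxl (N x) (N y)) (NE x Ux).
    have Ey := E_homo (leq_maxr (N x) (N y)) (NE y Uy).
    have [-> ->] := GN _ _ Ex; have [-> _] := GN _ _ Ey.
    by have [+ _] := @G_C1 (maxn (N x) (N y)) x I; apply.
  have [n nE] := E_cover Ux; have [_ Dx] := GN _ _ (nbhs_singleton nE).
  rewrite /prop_for /continuous_at Dx; have [_] := @G_C1 n x I; apply: cvg_trans.
  apply: near_eq_cvg; near=> y; have Ey : E n y by near: y.
  by have [_ ->] := GN _ _ Ey.
- by move=> x _; exact: G_ge0.
- by move=> n x Enx; have [-> _] := GN _ _ Enx; exact: G_ge.
- by move=> x M; exact: G_le.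
- by move=> x L; exact: DG_norm.
Unshelve. all: by end_near. Qed.

End LocallyFiniteSmoothMaximum.

(** * Approximation of a locally bounded convex function *)

Section Approximation.
Context {R : realType} {V : normedModType R}.
Variables (U : set V) (f : V -> R).
Hypotheses (U_convex : convex_set U) (f_convex : convex_function U f).

Lemma slope_bound_le k L x : k <= L -> slope_bound U f k x -> slope_bound U f L x.
Proof.
by move=> kL fk y Uy; apply: le_trans (fk y Uy); rewrite lerD2l lerN2 ler_wpM2r.
Qed.

(** By convexity, a bound on the slopes at short distance from [x] propagates
    along the segments issued from [x]. *)
Lemma slope_bound_of_local k (r : R) x : 0 < r -> U x ->
  (forall y, U y -> ball x r y -> f x - k * `|y - x| <= f y) ->
  slope_bound U f k x.
Proof.
move=> r0 Ux fx y Uy; have [->|yx] := eqVneq y x.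
  by rewrite subrr normr0 mulr0 subr0.
have a0 : 0 < `|y - x| by rewrite normr_gt0 subr_eq0.
pose t := Num.min 1 (r / (2 * `|y - x|)).
have t0 : 0 < t by rewrite lt_min ltr01 divr_gt0// mulr_gt0.
have t1 : t <= 1 by rewrite ge_min lexx.
have tr : t * `|y - x| < r.
  have : t <= r / (2 * `|y - x|) by rewrite ge_min lexx orbT.
  by rewrite ler_pdivlMr ?mulr_gt0//; lra.
pose z := t *: y + (1 - t) *: x.
have zx : z - x = t *: (y - x).
  by rewrite /z scalerBl scale1r addrA addrAC addrK scalerBr.
have Uz : U z by apply: convex_set_comb => //; rewrite t1 ltW.
have := fx z Uz; rewrite -ball_normE/= distrC zx normrZ gtr0_norm// => /(_ tr).
have /convex_functionP fc := f_convex.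
have := fc y x t Uy Ux; rewrite (ltW t0) t1 => /(_ isT) h1 h2.
by rewrite -(ler_pM2l t0); lra.
Qed.

(** For [w] in [U], the point [y] lies between [w] and a point of the larger
    ball on the other side; convexity bounds [f w] from below. *)
Lemma slope_bound_of_bounded (r M : R) x y : 0 < r ->
  ball x (2 * r) `<=` U -> (forall z, ball x (2 * r) z -> `|f z| <= M) ->
  ball x r y -> slope_bound U f (4 * M / r) y.
Proof.
move=> r0 xU fM xy w Uw; have [->|wy] := eqVneq w y.
  by rewrite subrr normr0 mulr0 subr0.
have a0 : 0 < `|w - y| by rewrite normr_gt0 subr_eq0.
rewrite -ball_normE/= in xU fM xy.
pose t := r / (2 * `|w - y|).
have t0 : 0 < t by rewrite divr_gt0// mulr_gt0.
have ta : t * `|w - y| = r / 2 by rewrite /t; field; rewrite gt_eqF.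
pose z := y - t *: (w - y).
have xz : `|x - z| < 2 * r.
  rewrite /z opprB addrCA addrC (le_lt_trans (ler_normD _ _))// normrZ gtr0_norm// ta.
  lra.
have xy2 : `|x - y| < 2 * r by lra.
have := fM _ xz; have := fM _ xy2; rewrite !ler_norml => fy fz.
pose s := (1 + t)^-1.
have s0 : 0 < s by rewrite invr_gt0; lra.
have s1 : s * (1 + t) = 1 by rewrite mulVf// gt_eqF; lra.
have yE : y = s *: z + (1 - s) *: w.
  have -> : 1 - s = s * t by rewrite -s1; ring.
  rewrite -scalerA -scalerDr /z scalerBr opprB addrA addrNK.
  by rewrite -{2}[y]scale1r -scalerDl scalerA s1 scale1r.
have /convex_functionP fc := f_convex.
have := fc z w s (xU _ xz) Uw; rewrite -yE => fyw.
have {}fyw : f y <= s * f z + (1 - s) * f w by apply: fyw; rewrite ltW//=; nra.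
have {fyw} h : (1 + t) * f y <= f z + t * f w.
  have : (1 + t) * f y <= (1 + t) * (s * f z + (1 - s) * f w).
    by rewrite ler_pM2l//; lra.
  suff -> : (1 + t) * (s * f z + (1 - s) * f w) = f z + t * f w by [].
  have -> : (1 + t) * (s * f z + (1 - s) * f w) =
    s * (1 + t) * f z + (1 + t - s * (1 + t)) * f w by ring.
  by rewrite s1; ring.
rewrite -(ler_pM2l t0) mulrBr.
have -> : t * (4 * M / r * `|w - y|) = 4 * M / r * (t * `|w - y|) by ring.
have -> : 4 * M / r * (t * `|w - y|) = 2 * M by rewrite ta; field; rewrite gt_eqF.
lra.
Qed.

Definition slope_level n : set V := [set x | U x /\ slope_bound U f n%:R x].

(** A small ball around [x] is bounded and at positive distance from the
    boundary, so [f] is bounded there, and its slopes are on a smaller ball. *)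
Lemma slope_level_cover : open U ->
  (forall B : set V, B `<=` U -> bounded_set B ->
    (0 < set_dist B (boundary U))%E -> [bounded f x | x in B]) ->
  forall x, U x -> exists n, \forall y \near x, slope_level n y.
Proof.
move=> oU fb x Ux.
have /nbhs_ballP[r r0 rU] : nbhs x U by exact: open_nbhs_nbhs.
have r2 : 0 < r / 2 by rewrite divr_gt0.
have r4 : 0 < r / 4 by rewrite divr_gt0.
have E4 : 2 * (r / 4) = r / 2 by lra.
have BU : ball x (r / 2) `<=` U by apply: subset_trans rU; apply: le_ball; lra.
have /pinfty_ex_gt0[M M0 fM] : [bounded f x | x in ball x (r / 2)].
  apply: fb => //.
    exists (`|x| + r); split=> [|m xm y]; first exact: num_real.
    rewrite -ball_normE/= distrC => yx.
    have := ler_normD (y - x) x; rewrite subrK => h; rewrite (le_trans h)//; lra.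
  apply: (@lt_le_trans _ _ (r / 2)%:E); first by rewrite lte_fin.
  apply: le_ereal_inf_tmp => _ [a xa [b [_ bU] <-]].
  rewrite lee_fin leNgt; apply/negP => ab; apply: bU.
  apply/open_nbhs_nbhs; split=> //; apply: rU.
  rewrite -ball_normE/= in xa *.
  have := ler_distD a x b; lra.
exists (Num.truncn (4 * M / (r / 4))).+1; near=> y.
have xy : ball x (r / 4) y by near: y; exact: nbhsx_ballx.
split.
  by apply: BU; apply: le_ball xy; lra.
apply: slope_bound_le (slope_bound_of_bounded r4 _ _ xy); rewrite ?E4//.
by apply/ltW/truncnS_gt.
Unshelve. all: by end_near. Qed.

(** The lower bound by an infimal convolution forces [g] to have the same
    minimizers as [f], and the last clause is the pointwise form of the
    preservation of local Lipschitz constants. *)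
Definition smoothing e (g : V -> R) (D : V -> dual_space V) :=
  [/\ C1_convex U g D,
      forall x, U x -> infconv U f 1 x <= g x,
      forall x, U x -> f x - e <= g x <= f x &
      forall x L, U x -> 0 <= L -> slope_bound U f L x -> `|D x| <= L].

Hypothesis V_luc : locally_uniformly_convex (dual_space V).
Hypothesis f_cover : forall x, U x -> exists n, \forall y \near x, slope_level n y.

Lemma slope_level_homo m n : (m <= n)%N -> slope_level m `<=` slope_level n.
Proof.
by move=> mn x [Ux fx]; split => //; apply: slope_bound_le fx; rewrite ler_nat.
Qed.

Lemma infconv_C1 c : 0 < c -> U !=set0 ->
  exists D, C1_convex [set: V] (infconv U f c) D.
Proof.
move=> c0 [x0 Ux0]; have [n /nbhs_singleton[_ fx0]] := f_cover Ux0.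
have n0 : 0 <= n%:R :> R by [].
have /choice[D DP] : forall x, exists p, subgradient [set: V] (infconv U f c) x p.
  by move=> x; exact: (infconv_subgradient_exists Ux0 n0 fx0).
exists D => x _; split; first exact: DP.
apply/cvgrPdist_lt => e e0.
have [d d0 dP] := infconv_subgradient_continuous Ux0 n0 fx0 V_luc c0 e0 (DP x).
near=> z; apply: (dP z); last exact: DP.
near: z; apply/nbhs_normP; exists d => //= z; by rewrite distrC.
Unshelve. all: by end_near. Qed.

(** The infimal convolutions with stiffness [c n], lowered by offsets [o n]
    increasing to [e / 2], form a sequence which on each slope level ends up
    decreasing while staying close to [f]. *)
Lemma smoothing_exists e : 0 < e -> U !=set0 -> exists g D, smoothing e g D.
Proof.
move=> e0 U0; have [x0 Ux0] := U0.
have [n0 /nbhs_singleton[_ fx0]] := f_cover Ux0.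
have n0_ge0 : 0 <= n0%:R :> R by [].
pose w n : R := 2^-1 ^+ n.
have w0 n : 0 < w n by rewrite exprn_gt0// invr_gt0.
have wS n : w n.+1 = w n / 2 by rewrite /w exprSr.
pose c n : R := 1 + 2 * n%:R ^+ 2 / (e * w n).
have c1 n : 1 <= c n.
  by rewrite lerDl divr_ge0// mulr_ge0 ?sqr_ge0// ltW.
have c0 n : 0 < c n by rewrite (lt_le_trans ltr01).
pose o n := e / 2 * (1 - w n).
have o0 n : 0 <= o n.
  have : w n <= 1 by rewrite exprn_ile1 ?invr_ge0// invf_le1// ler1n.
  by rewrite /o; nra.
have /choice[Dh DhP] : forall n, exists D, C1_convex [set: V] (infconv U f (c n)) D.
  by move=> n; exact: (infconv_C1 (c0 n) U0).
pose h n x := infconv U f (c n) x - o n.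
pose d n := e * w n / 4.
have d0 n : 0 < d n by rewrite divr_gt0// mulr_gt0.
have h_le n x : U x -> h n x <= f x - o n.
  by move=> Ux; rewrite lerD2r (infconv_le_self Ux0 n0_ge0 fx0).
(* [c n] is chosen so that on the n-th level [h n] is close to [f - o n] *)
have h_ge n x : slope_level n x -> f x - e * w n / 8 - o n <= h n x.
  move=> [Ux fx]; rewrite lerD2r (le_trans _ (infconv_near Ux0 (c0 n) fx))//.
  rewrite lerD2l lerN2 ler_pdivrMr ?mulr_gt0//.
  have : 0 < e * w n by rewrite mulr_gt0.
  have : c n * (e * w n) = e * w n + 2 * n%:R ^+ 2.
    by rewrite /c mulrDl mul1r divfK// mulf_neq0// gt_eqF.
  lra.
have hC n : C1_convex [set: V] (h n) (Dh n).
  move=> x _; have [gx Dx] := DhP n x I; split => // y _.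
  by have := gx y I; rewrite /h; lra.
have h_decr n x : slope_level n x -> h n.+1 x + d n / 2 <= h n x.
  move=> Enx; have Ux := Enx.1.
  have := h_ge n x Enx; have := h_le n.+1 x Ux; rewrite /d /o wS; lra.
have E_sub n : slope_level n `<=` U by move=> x [].
have [g [D [gD g_ge0 g_ge g_le D_le]]] :=
  locally_finite_smoothmax d0 hC slope_level_homo E_sub f_cover h_decr.
exists g, D; split => //.
- move=> x Ux; rewrite (le_trans _ (g_ge0 x Ux))//.
  by rewrite /h /o /c expr0n/= mulr0 mul0r addr0 /w expr0 subrr mulr0 subr0.
- move=> x Ux; apply/andP; split.
    have [n /nbhs_singleton Enx] := f_cover Ux.
    have := g_ge n x Enx; have := h_ge n x Enx; rewrite /d /o.
    have : 0 < e * w n by rewrite mulr_gt0.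
    lra.
  apply: g_le => n; have := h_le n x Ux; have := o0 n; lra.
- move=> x L Ux L0 fx; apply: D_le => n.
  have [Dx _] := DhP n x I.
  exact: (infconv_subgradient_norm Ux0 n0_ge0 fx0 (c0 n) L0 Ux fx Dx).
Qed.

End Approximation.

(** * Averages with geometric weights *)

Section GeometricMean.
Context {R : realType}.
Implicit Types (u v : nat -> R) (M : R).

Definition partial_mean u n : R := \sum_(j < n) 2^-1 ^+ j.+1 * u j.

Definition mean u : R := limn (partial_mean u).

Definition seq_bounded u := exists M, forall j, `|u j| <= M.

Lemma half_gt0 n : 0 < 2^-1 ^+ n :> R.
Proof. by rewrite exprn_gt0// invr_gt0. Qed.

Lemma partial_mean_cst M n : partial_mean (fun=> M) n = M - M * 2^-1 ^+ n.
Proof.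
rewrite /partial_mean; elim: n => [|n IH].
  by rewrite big_ord0 expr0 mulr1 subrr.
by rewrite big_ord_recr/= IH exprS; lra.
Qed.

Lemma partial_mean_nondecreasing u : (forall j, 0 <= u j) ->
  {homo partial_mean u : m n / (m <= n)%N >-> m <= n}.
Proof.
move=> u0; apply: homo_leq => // [x y z|n]; first exact: le_trans.
by rewrite /partial_mean big_ord_recr/= lerDl mulr_ge0// ltW// half_gt0.
Qed.

Lemma partial_mean_le u v n : (forall j, u j <= v j) ->
  partial_mean u n <= partial_mean v n.
Proof.
by move=> uv; apply: ler_sum => j _; rewrite ler_wpM2l// ltW// half_gt0.
Qed.

Lemma partial_meanD u v n :
  partial_mean (fun j => u j + v j) n = partial_mean u n + partial_mean v n.
Proof. by rewrite -big_split/=; apply: eq_bigr => j _; rewrite mulrDr. Qed.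

Lemma partial_meanZ a u n :
  partial_mean (fun j => a * u j) n = a * partial_mean u n.
Proof. by rewrite mulr_sumr; apply: eq_bigr => j _; rewrite mulrCA. Qed.

Lemma partial_mean_cst_cvg M : partial_mean (fun=> M) @ \oo --> M.
Proof.
rewrite (_ : partial_mean _ = fun n => M - M * 2^-1 ^+ n); last first.
  by apply/funext => n; exact: partial_mean_cst.
rewrite -[X in _ --> X]subr0 -[X in _ --> _ - X](mulr0 M).
apply: cvgB; first exact: cvg_cst.
by apply: cvgM; [exact: cvg_cst|apply: cvg_expr]; rewrite ger0_norm ?invr_ge0// invf_lt1// ltr1n.
Qed.

Lemma partial_mean_cvg u : seq_bounded u -> cvgn (partial_mean u).
Proof.
move=> [M uM].
have -> : partial_mean u = (fun n => partial_mean (fun j => u j + M) n -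
    partial_mean (fun=> M) n).
  by apply/funext => n; rewrite partial_meanD addrK.
apply: is_cvgB; last by apply: cvgP; exact: partial_mean_cst_cvg.
apply: nondecreasing_is_cvgn.
  apply: partial_mean_nondecreasing => j.
  by have := uM j; rewrite ler_norml; lra.
exists (2 * M) => _ [n _ <-].
apply: (@le_trans _ _ (partial_mean (fun=> 2 * M) n)).
  by apply: partial_mean_le => j; have := uM j; rewrite ler_norml; lra.
rewrite partial_mean_cst gerBl; apply: mulr_ge0; last exact/ltW/half_gt0.
by apply: mulr_ge0 => //; exact: le_trans (normr_ge0 _) (uM 0%N).
Qed.

Lemma mean_cst M : mean (fun=> M) = M.
Proof. exact: cvg_lim (@partial_mean_cst_cvg M). Qed.

Lemma meanD u v : seq_bounded u -> seq_bounded v ->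
  mean (fun j => u j + v j) = mean u + mean v.
Proof.
move=> bu bv; rewrite /mean -limD; try exact: partial_mean_cvg.
by congr (limn _); apply/funext => n; rewrite partial_meanD.
Qed.

Lemma meanZ a u : seq_bounded u -> mean (fun j => a * u j) = a * mean u.
Proof.
move=> bu; apply: cvg_lim => //.
rewrite (_ : partial_mean _ = fun n => a * partial_mean u n); last first.
  by apply/funext => n; rewrite partial_meanZ.
by apply: cvgM; [exact: cvg_cst|exact: partial_mean_cvg].
Qed.

Lemma mean_le u v : seq_bounded u -> seq_bounded v ->
  (forall j, u j <= v j) -> mean u <= mean v.
Proof.
move=> bu bv uv; apply: ler_lim; try exact: partial_mean_cvg.
by near=> n; exact: partial_mean_le.
Unshelve. all: by end_near. Qed.

Lemma partial_mean_le_mean u n : seq_bounded u -> (forall j, 0 <= u j) ->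
  partial_mean u n <= mean u.
Proof.
move=> bu u0; apply: nondecreasing_cvgn_le; last exact: partial_mean_cvg.
exact: partial_mean_nondecreasing.
Qed.

Lemma seq_boundedD u v : seq_bounded u -> seq_bounded v ->
  seq_bounded (fun j => u j + v j).
Proof.
move=> [M uM] [N vN]; exists (M + N) => j.
by rewrite (le_trans (ler_normD _ _))// lerD.
Qed.

Lemma seq_boundedZ a u : seq_bounded u -> seq_bounded (fun j => a * u j).
Proof.
by move=> [M uM]; exists (`|a| * M) => j; rewrite normrM ler_wpM2l.
Qed.

Lemma seq_bounded_cst M : seq_bounded (fun=> M).
Proof. by exists `|M|. Qed.

Lemma mean_lt u v k : seq_bounded u -> seq_bounded v ->
  (forall j, u j <= v j) -> u k < v k -> mean u < mean v.
Proof.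
move=> bu bv uv uvk.
have bNu : seq_bounded (fun j => -1 * u j) by exact: seq_boundedZ.
have buv : seq_bounded (fun j => v j + -1 * u j) by exact: seq_boundedD.
have uv0 j : 0 <= v j + -1 * u j by have := uv j; lra.
have := partial_mean_le_mean k.+1 buv uv0; rewrite meanD// meanZ//.
suff : 0 < partial_mean (fun j => v j + -1 * u j) k.+1 by lra.
rewrite /partial_mean big_ord_recr/= ltr_wpDl//.
  by apply: sumr_ge0 => j _; rewrite mulr_ge0// ltW// half_gt0.
by rewrite mulr_gt0 ?half_gt0//; lra.
Qed.

(** The weights of the indices [j >= N] add up to [2^-1 ^+ N]. *)
Lemma mean_le_split u a M N : seq_bounded u ->
  0 <= a -> 0 <= M -> (forall j, (j < N)%N -> u j <= a) -> (forall j, u j <= M) ->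
  mean u <= a + M * 2^-1 ^+ N.
Proof.
move=> bu a0 M0 ua uM.
pose v j : R := if (j < N)%N then 1 else 0.
have bv : seq_bounded v by exists 1 => j; rewrite /v; case: ifP; rewrite ?normr1 ?normr0.
have v0 j : 0 <= v j by rewrite /v; case: ifP.
have bb : seq_bounded (fun j => a + M + (- M) * v j).
  by apply: seq_boundedD; [exact: seq_bounded_cst|exact: seq_boundedZ].
apply: (@le_trans _ _ (mean (fun j => a + M + (- M) * v j))).
  apply: mean_le => // j; rewrite /v; case: ifP => [/ua|_]; first by lra.
  by have := uM j; lra.
have bMv : seq_bounded (fun j => - M * v j) by exact: seq_boundedZ.
rewrite meanD//; last exact: seq_bounded_cst.
rewrite mean_cst meanZ//.
have := partial_mean_le_mean N bv v0.
have -> : partial_mean v N = partial_mean (fun=> 1) N.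
  by apply: eq_bigr => j _; rewrite /v ltn_ord.
rewrite partial_mean_cst => /(ler_wpM2l M0); lra.
Qed.

End GeometricMean.

(** * Strict convexity *)

Section MeanOfSmoothings.
Context {R : realType} {V : normedModType R}.
Variables (U : set V) (f : V -> R).
Hypotheses (U_convex : convex_set U) (f_convex : convex_function U f).
Hypothesis V_luc : locally_uniformly_convex (dual_space V).
Hypothesis f_cover : forall x, U x -> exists n, \forall y \near x, slope_level U f n y.

(** The average of smoothings at scales tending to [0]: were it affine on a
    segment, each of them would be, and so would their limit [f]. Averaging
    preserves the other properties because the gradients are bounded by the
    slopes of [f], uniformly over the sequence. *)
Lemma smoothing_strict e : 0 < e -> U !=set0 -> exists g D,
  smoothing U f e g D /\
  (strictly_convex_function U f -> strictly_convex_function U g).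
Proof.
move=> e0 U0.
pose e_ j : R := e / j.+1%:R.
have e_gt0 j : 0 < e_ j by rewrite divr_gt0.
have e_le j : e_ j <= e by rewrite ler_pdivrMr// ler_peMr ?ler1n// ltW.
have /choice[g_ /choice[D_ gD]] : forall j, exists g, exists D, smoothing U f (e_ j) g D.
  by move=> j; exact: smoothing_exists.
have g_le j x : U x -> f x - e_ j <= g_ j x <= f x by have [_ _ + _] := gD j; apply.
have g_bd x : U x -> seq_bounded (fun j => g_ j x).
  move=> Ux; exists (`|f x| + e) => j; have := g_le j x Ux; have := e_le j.
  have := ler_norm (f x); have := ler_norm (- f x); rewrite normrN ler_norml.
  by move: (e_gt0 j); lra.
have D_le n j x : slope_level U f n x -> `|D_ j x| <= n%:R.
  by move=> [Ux fx]; have [_ _ _] := gD j; apply.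
have Dv_le n j x v : slope_level U f n x -> `|D_ j x v| <= n%:R * `|v|.
  move=> Enx; rewrite (le_trans (dual_le_norm _ _))// ler_wpM2r//.
  exact: D_le.
have D_bd x v : U x -> seq_bounded (fun j => D_ j x v).
  move=> Ux; have [n /nbhs_singleton Enx] := f_cover Ux.
  by exists (n%:R * `|v|) => j; exact: Dv_le.
have /choice[D DE] : forall x, exists p : dual_space V,
    U x -> forall v, p v = mean (fun j => D_ j x v).
  move=> x; have [Ux|Ux] := pselect (U x); last by exists 0.
  have [n /nbhs_singleton Enx] := f_cover Ux.
  have [||p pE] := @dual_of_linear R V (fun v => mean (fun j => D_ j x v)) n%:R.
  - move=> a v w; rewrite -[X in _ = X + _]/(a * mean (fun j => D_ j x v)).
    rewrite -(meanZ a (D_bd x v Ux)) -meanD; first last.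
    + exact: D_bd.
    + by apply: seq_boundedZ; exact: D_bd.
    by congr mean; apply/funext => j; rewrite linearP.
  - move=> v; rewrite ler_norml -(mean_cst (n%:R * `|v|)) -mulN1r -meanZ; last exact: seq_bounded_cst.
    have nv j := Dv_le n j x v Enx.
    apply/andP; split; apply: mean_le; try exact: D_bd; try exact: seq_bounded_cst.
    + by move=> j; rewrite mulN1r; have := nv j; rewrite ler_norml => /andP[].
    + by move=> j; have := nv j; rewrite ler_norml => /andP[].
  by exists p => _.
pose g x := mean (fun j => g_ j x).
have D_cont x : U x -> {for x, continuous D}.
  move=> Ux; have [n nE] := f_cover Ux.
  have Enx := nbhs_singleton nE.
  apply/cvgrPdist_lt => a a0.
  have [N N_lt] : exists N, (n + n)%:R * 2^-1 ^+ N < a / 2.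
    have : (n + n)%:R * 2^-1 ^+ N @[N --> \oo] --> (0 : R).
      rewrite -[X in _ --> X](mulr0 (n + n)%:R).
      by apply: cvgM; [exact: cvg_cst|apply: cvg_expr];
        rewrite ger0_norm ?invr_ge0// invf_lt1// ltr1n.
    move=> /cvgr_lt/(_ (a / 2)); rewrite divr_gt0// => /(_ isT) [N _ /(_ N (leqnn N))].
    by exists N.
  near=> z.
  have Enz : slope_level U f n z by near: z.
  have Uz := Enz.1.
  have Dz (j : 'I_N) : `|D_ j x - D_ j z| < a / 2.
    move: j; near: z; apply: filter_forall => j.
    have [gC _ _ _] := gD j; have [_] := gC x Ux.
    by move=> /cvgrPdist_lt; apply; rewrite divr_gt0.
  suff : `|D x - D z| <= a / 2 + (n + n)%:R * 2^-1 ^+ N by lra.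
  apply: dual_norm_le => v v1; rewrite dualB_apply (DE x Ux) (DE z Uz).
  rewrite -[- mean _]mulN1r -meanZ; last exact: D_bd.
  have bz : seq_bounded (fun j => -1 * D_ j z v) by apply: seq_boundedZ; exact: D_bd.
  rewrite -meanD//; last exact: D_bd.
  apply: mean_le_split => //.
  - by apply: seq_boundedD => //; exact: D_bd.
  - by rewrite divr_ge0// ltW.
  - move=> j jN; have := dual_apply_le (D_ j x - D_ j z) v.
    rewrite dualB_apply mulN1r => /le_trans; apply.
    rewrite -[a / 2]mulr1; apply: ler_pM => //.
    exact/ltW/(Dz (Ordinal jN)).
  - move=> j; have := D_le n j x Enx; have := D_le n j z Enz => hz hx.
    have := dual_apply_le (D_ j x - D_ j z) v.
    rewrite dualB_apply mulN1r => /le_trans; apply.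
    rewrite -[_%:R]mulr1; apply: ler_pM => //.
    by rewrite (le_trans (ler_normB _ _))// natrD lerD.
exists g, D; split; first split.
- move=> x Ux; split=> [y Uy|]; last exact: D_cont.
  have bg := g_bd x Ux; have bD := D_bd x (y - x) Ux.
  rewrite (DE x Ux) -meanD//.
  apply: mean_le; [exact: seq_boundedD|exact: g_bd|].
  by move=> j; have [gC _ _ _] := gD j; have [+ _] := gC x Ux; apply.
- move=> x Ux; rewrite -(mean_cst (infconv _ _ _ _)).
  apply: mean_le; [exact: seq_bounded_cst|exact: g_bd|].
  by move=> j; have [_ + _ _] := gD j; apply.
- move=> x Ux; apply/andP; split.
    rewrite -(mean_cst (f x - e)).
    apply: mean_le; [exact: seq_bounded_cst|exact: g_bd|] => j.
    by have /andP[+ _] := g_le j x Ux; apply: le_trans; rewrite lerD2l lerN2.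
  rewrite -(mean_cst (f x)).
  apply: mean_le; [exact: g_bd|exact: seq_bounded_cst|] => j.
  by have /andP[_ +] := g_le j x Ux.
- move=> x L Ux L0 fx; apply: dual_norm_le => v v1.
  rewrite (DE x Ux) -(mean_cst L).
  apply: mean_le; [exact: D_bd|exact: seq_bounded_cst|] => j.
  rewrite (le_trans (dual_apply_le _ _))// -[L]mulr1 ler_pM//.
  by have [_ _ _] := gD j; apply.
move=> fstrict x y Ux Uy xy t t0 t1.
have t1' : 0 < 1 - t by lra.
pose z := (1 - t) *: x + t *: y.
have zE : z = (1 - t) *: x + (1 - (1 - t)) *: y by rewrite subKr.
have t01 : 0 <= 1 - t <= 1 by lra.
have Uz : U z by rewrite zE; exact: convex_set_comb.
have gc j : g_ j z <= (1 - t) * g_ j x + t * g_ j y.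
  have [gC _ _ _] := gD j.
  have /convex_functionP/(_ x y (1 - t) Ux Uy t01) := C1_convex_convex U_convex gC.
  by rewrite -zE subKr.
have [k gk] : exists k, g_ k z < (1 - t) * g_ k x + t * g_ k y.
  apply/not_existsP => gk.
  have := fstrict x y Ux Uy xy t t0 t1; rewrite -subr_gt0 -/z.
  set a := _ - f z => a0.
  pose k := Num.truncn (e / a).
  have ek : e_ k < a.
    by rewrite ltr_pdivrMr// mulrC -ltr_pdivrMr// truncnS_gt.
  have := gk k; move=> /negP; rewrite -leNgt => {}gk.
  have /andP[_ gz] := g_le k z Uz.
  have /andP[/(ler_wpM2l (ltW t1')) gx _] := g_le k x Ux.
  have /andP[/(ler_wpM2l (ltW t0)) gy _] := g_le k y Uy.
  by move: ek; rewrite /a; lra.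
have bx := g_bd x Ux; have b_y := g_bd y Uy.
rewrite /g -!meanZ// -meanD; try exact: seq_boundedZ.
apply: (mean_lt (k := k)) => //; first exact: g_bd.
by apply: seq_boundedD; exact: seq_boundedZ.
Unshelve. all: by end_near. Qed.

End MeanOfSmoothings.

(** * Minimizers and local Lipschitz constants *)

Section Consequences.
Context {R : realType} {V : normedModType R}.
Variables (U : set V) (f : V -> R).

(** An infimal convolution has the same infimum as [f]; if it attains it at
    [x], the points [y] almost realizing the infimum that defines its value
    tend to [x], and [f] is continuous there. *)
Lemma minimizers_between_infconv c (g : V -> R) : 0 < c ->
  (forall x, U x -> exists2 L : R, 0 <= L & slope_bound U f L x) ->
  (forall x, U x -> infconv U f c x <= g x <= f x) ->
  minimizers U g = minimizers U f.
Proof.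
move=> c0 fL gf; apply/seteqP; split=> x [Ux xmin]; split=> // y Uy; last first.
  have [L L0 fx] := fL x Ux.
  have /andP[_ gx] := gf x Ux; have /andP[gy _] := gf y Uy.
  apply: le_trans gx (le_trans _ gy).
  apply: (infconv_ge Ux) => z Uz; rewrite (le_trans (xmin z Uz))// lerDl.
  by rewrite mulr_ge0 ?sqr_ge0// ltW.
have [L L0 fx] := fL x Ux.
set m := infconv U f c x.
have mf z : U z -> m <= f z.
  move=> Uz; have /andP[h _] := gf x Ux; have /andP[_ h'] := gf z Uz.
  exact: le_trans h (le_trans (xmin z Uz) h').
apply: le_trans (mf y Uy); rewrite leNgt; apply/negP => mfx.
(* a near-minimizer [z] of the infimum defining [m] is close to [x], since
   [m <= f z], so [f x] cannot exceed [m] by more than the slope allows *)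
pose t := Num.min 1 ((f x - m) / (2 * (c + L + 1))).
have cL : 0 < 2 * (c + L + 1) by lra.
have t0 : 0 < t by rewrite lt_min ltr01 divr_gt0// subr_gt0.
have t1 : t <= 1 by rewrite ge_min lexx.
have tm : t * (2 * (c + L + 1)) <= f x - m.
  by rewrite -ler_pdivlMr// ge_min lexx orbT.
have ct0 : 0 < c * t ^+ 2 by rewrite mulr_gt0// exprn_gt0.
have [_ [z Uz <-]] := inf_adherent ct0 (infconv_has_inf Ux L0 fx x c0).
rewrite -/(infconv U f c x) -/m => zx.
have xz : `|x - z| <= t.
  have : c * `|x - z| ^+ 2 <= c * t ^+ 2 by have := mf z Uz; lra.
  by rewrite ler_pM2l// ler_pXn2r ?nnegrE// ltW.
have := fx z Uz; rewrite distrC => fz.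
have : L * `|x - z| <= L * t by rewrite ler_wpM2l.
have : 0 <= c * `|x - z| ^+ 2 by rewrite mulr_ge0 ?sqr_ge0// ltW.
have : c * t ^+ 2 <= c * t by rewrite ler_pM2l// ler_piMl// ltW.
have : 0 <= L * t by rewrite mulr_ge0// ltW.
have : 0 < c * t by rewrite mulr_gt0.
lra.
Qed.

Lemma preserves_local_Lip_of_gradient_bound e (g : V -> R) D : 0 <= e ->
  convex_set U -> convex_function U f -> C1_convex U g D ->
  (forall x L, U x -> 0 <= L -> slope_bound U f L x -> `|D x| <= L) ->
  preserves_local_Lip e U f g.
Proof.
move=> e0 Uc fc gD D_le x r r0 xU.
apply: ereal_inf_le_tmp => _ [k [k0 flip] <-]; exists k => //; split=> //.
have Dk z : ball x r z -> `|D z| <= k.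
  move=> xz; have Uz := xU z xz; apply: D_le => //.
  move: (xz); rewrite -ball_normE/= => xz'.
  apply: (@slope_bound_of_local _ _ _ _ Uc fc k (r - `|x - z|)) => //.
    by rewrite subr_gt0.
  move=> y Uy zy.
  have xy : `|x - y| < r.
    move: zy; rewrite -ball_normE/= => zy.
    by have := ler_distD z x y; lra.
  have xe w : `|x - w| < r -> ball x ((1 + e) * r) w.
    move=> xw; rewrite -ball_normE/=; apply: lt_le_trans xw _.
    by have : 0 <= e * r by [rewrite mulr_ge0// ltW]; lra.
  have /= := flip (y, z) (conj (conj (xe y xy) Uy) (conj (xe z xz') Uz)).
  by rewrite ler_norml => /andP[]; lra.
move=> [y z] [/= xy xz].
have Uy := xU y xy; have Uz := xU z xz.
have [gy _] := gD y Uy; have [gz _] := gD z Uz.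
have := gy z Uz; have := gz y Uy.
have := dual_le_norm (D y) (z - y); have := dual_le_norm (D z) (y - z).
have := ler_wpM2r (normr_ge0 (y - z)) (Dk y xy).
have := ler_wpM2r (normr_ge0 (y - z)) (Dk z xz).
rewrite (distrC z y) !ler_norml; lra.
Qed.

End Consequences.

Theorem corollary3 (R : realType) (X : completeNormedModType R)
  (X_LUC : locally_uniformly_convex (dual_space X))
  (U : set X) (U_open : open U) (U_convex : convex_set U)
  (f : X -> R) (f_convex : convex_function U f)
  (f_bounded : forall B : set X, B `<=` U -> bounded_set B ->
    (0 < set_dist B (boundary U))%E -> [bounded f x | x in B])
  (e : R) (e_gt0 : 0 < e) :
  exists g : X -> R,
    [/\ C1_on U g /\ convex_function U g,
        forall x, U x -> f x - e <= g x <= f x,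
        minimizers U g = minimizers U f,
        preserves_local_Lip e U f g
      & strictly_convex_function U f -> reflexive_space X ->
        strictly_convex_function U g].
Proof.
have f_cover := slope_level_cover f_convex U_open f_bounded.
suff [g [D [[gD g_ge g_near D_le] g_strict]]] : exists g D, smoothing U f e g D /\
    (strictly_convex_function U f -> strictly_convex_function U g).
  exists g; split => //.
  - split; last exact: (C1_convex_convex U_convex gD).
    exists D => x; first exact: C1_convex_is_diff.
    by rewrite inE => /gD[].
  - apply: (@minimizers_between_infconv _ _ _ _ 1) => // x Ux.
      by have [n /nbhs_singleton[_ fx]] := f_cover x Ux; exists n%:R.
    by rewrite g_ge//=; have /andP[] := g_near x Ux.
  - exact: (preserves_local_Lip_of_gradient_bound (ltW e_gt0) U_convex f_convex gD D_le).
  - by move=> /g_strict.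
have [U0|U0] := pselect (U !=set0); first exact: smoothing_strict.
have nU x : ~ U x by move=> Ux; apply: U0; exists x.
exists f, (fun=> 0); split=> //.
by split=> x => [/nU|/nU|/nU|? /nU].
Qed.
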